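(* Let $(\mathcal{C},\mathbb{E},\mathfrak{s})$ be an extriangulated category and let $\mathcal{X}$ be a pseudo cluster tilting subcategory of $\mathcal{C}$. Then the quotient category $\mathcal{C}/\mathcal{X}$ is a semi-abelian category.
   Context: **Extriangulated categories (Nakaoka–Palu).** Let $\mathcal{C}$ be an additive category and $\mathbb{E}:\mathcal{C}^{\mathrm{op}}\times\mathcal{C}\to\mathrm{Ab}$ an additive bifunctor. An element $\delta\in\mathbb{E}(C,A)$ is called an $\mathbb{E}$-extension. For $a:A\to A'$ and $c:C'\to C$ put $a_*\delta=\mathbb{E}(C,a)(\delta)\in\mathbb{E}(C,A')$ and $c^*\delta=\mathbb{E}(c,A)(\delta)\in\mathbb{E}(C',A)$. A morphism of extensions from $\delta\in\mathbb{E}(C,A)$ to $\delta'\in\mathbb{E}(C',A')$ is a pair $(a:A\to A',\,c:C\to C')$ with $a_*\delta=c^*\delta'$. Two sequences $A\xrightarrow{x}B\xrightarrow{y}C$ and $A\xrightarrow{x'}B'\xrightarrow{y'}C$ are equivalent if there is an isomorphism $b:B\to B'$ with $bx=x'$ and $y'b=y$. A realization $\mathfrak{s}$ assigns to each $\delta\in\mathbb{E}(C,A)$ an equivalence class $\mathfrak{s}(\delta)=[A\xrightarrow{x}B\xrightarrow{y}C]$ such that for every morphism $(a,c):\delta\to\delta'$, with $\mathfrak{s}(\delta)=[A\xrightarrow{x}B\xrightarrow{y}C]$ and $\mathfrak{s}(\delta')=[A'\xrightarrow{x'}B'\xrightarrow{y'}C']$, there is $b:B\to B'$ with $bx=x'a$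 and $y'b=cy$. It is additive if $\mathfrak{s}(0)=[A\to A\oplus C\to C]$ (canonical injection and projection) and $\mathfrak{s}(\delta\oplus\delta')=\mathfrak{s}(\delta)\oplus\mathfrak{s}(\delta')$. The triple $(\mathcal{C},\mathbb{E},\mathfrak{s})$ is an extriangulated category if $\mathbb{E}$ is an additive bifunctor, $\mathfrak{s}$ is an additive realization of $\mathbb{E}$, and the following hold. (ET3) If $\mathfrak{s}(\delta)=[A\xrightarrow{x}B\xrightarrow{y}C]$, $\mathfrak{s}(\delta')=[A'\xrightarrow{x'}B'\xrightarrow{y'}C']$ and $a:A\to A'$, $b:B\to B'$ satisfy $bx=x'a$, then there is $c:C\to C'$ with $cy=y'b$ and $a_*\delta=c^*\delta'$. (ET3)$^{\mathrm{op}}$ Dually, given $b,c$ with $y'b=cy$ there is $a$ with $bx=x'a$ and $a_*\delta=c^*\delta'$. (ET4) If $\delta\in\mathbb{E}(D,A)$ and $\delta'\in\mathbb{E}(F,B)$ are realized by $A\xrightarrow{f}B\xrightarrow{f'}D$ and $B\xrightarrow{g}C\xrightarrow{g'}F$, then there are an object $W$, morphisms $h'=h':C\to W$, $d:D\to W$, $e:W\to F$ and $\delta''\in\mathbb{E}(W,A)$ realized by $A\xrightarrow{gf}C\xrightarrow{h'}W$ such that $h'g=df'$, $eh'=g'$, $D\xrightarrow{d}W\xrightarrow{e}F$ realizes $f'_*\delta'$, $d^*\delta''=\delta$ and $f_*\delta''=e^*\delta'$. (ET4)$^{\mathrm{op}}$ The dual of (ET4). An $\mathbb{E}$-triangle $A\xrightarrow{x}B\xrightarrow{y}C\overset{\delta}{\dashrightarrow}$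 is a sequence $A\xrightarrow{x}B\xrightarrow{y}C$ together with $\delta\in\mathbb{E}(C,A)$ such that $\mathfrak{s}(\delta)=[A\xrightarrow{x}B\xrightarrow{y}C]$ (the symbol $\delta$ may be omitted). **Approximations.** All subcategories are full. For a subcategory $\mathcal{X}$ of $\mathcal{C}$, a morphism $f:A\to B$ is a left $\mathcal{X}$-approximation of $A$ if $B\in\mathcal{X}$ and $\mathcal{C}(f,X):\mathcal{C}(B,X)\to\mathcal{C}(A,X)$ is surjective for all $X\in\mathcal{X}$; it is a right $\mathcal{X}$-approximation of $B$ if $A\in\mathcal{X}$ and $\mathcal{C}(X,f):\mathcal{C}(X,A)\to\mathcal{C}(X,B)$ is surjective for all $X\in\mathcal{X}$. **Pseudo cluster tilting.** $\mathcal{X}$ is a pseudo cluster tilting subcategory of $\mathcal{C}$ if: $(2')$ for any $C\in\mathcal{C}$ there is an $\mathbb{E}$-triangle $C\xrightarrow{a}X_1\xrightarrow{b}X_2\dashrightarrow$ with $X_1,X_2\in\mathcal{X}$ and $a$ a left $\mathcal{X}$-approximation of $C$; $(3')$ for any $C\in\mathcal{C}$ there is an $\mathbb{E}$-triangle $X_3\xrightarrow{c}X_4\xrightarrow{d}C\dashrightarrow$ with $X_3,X_4\in\mathcal{X}$ and $d$ a right $\mathcal{X}$-approximation of $C$. **Quotient category.** $\mathcal{X}$ is assumed closed under finite direct sums. $\mathcal{C}/\mathcal{X}$ has the same objects as $\mathcal{C}$ and morphism groups $\mathrm{Hom}_{\mathcal{C}}(A,B)/\mathcal{X}(A,B)$,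 where $\mathcal{X}(A,B)$ is the subgroup of morphisms $A\to B$ factoring through an object of $\mathcal{X}$. **Semi-abelian.** An additive category with kernels and cokernels is semi-abelian if for every morphism $f:X\to Y$ the canonical morphism $\hat f:\mathrm{Coim}\,f\to\mathrm{Im}\,f$ (from the cokernel of the kernel of $f$ to the kernel of the cokernel of $f$) is both an epimorphism and a monomorphism. *)

(* Defs.v *)
From HB Require Import structures.
From mathcomp Require Import all_boot all_algebra.
From mathcomp Require Import boolp.

Set Implicit Arguments.
Unset Strict Implicit.
Unset Printing Implicit Defensive.

Import GRing.Theory.

Declare Scope cat_scope.
Delimit Scope cat_scope with cat.
Local Open Scope ring_scope.
Local Open Scope quotient_scope.
Local Open Scope cat_scope.

(* The choiceType component of the zmodType Hom A B is no restriction: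
   classically every type carries one. *)
Record preadditive := Preadditive {
  Ob :> Type;
  Hom : Ob -> Ob -> zmodType;
  idm : forall A, Hom A A;
  comp : forall A B C, Hom B C -> Hom A B -> Hom A C;
  compA : forall A B C D (h : Hom C D) (g : Hom B C) (f : Hom A B),
    comp h (comp g f) = comp (comp h g) f;
  comp1m : forall A B (f : Hom A B), comp (idm B) f = f;
  compm1 : forall A B (f : Hom A B), comp f (idm A) = f;
  compDl : forall A B C (g g' : Hom B C) (f : Hom A B),
    comp (g + g') f = comp g f + comp g' f;
  compDr : forall A B C (g : Hom B C) (f f' : Hom A B),
    comp g (f + f') = comp g f + comp g f' }.

Arguments idm {p} A.
Notation "g ∘ f" := (comp g f) (at level 40, left associativity) : cat_scope.

Section Preadditive.
Variable C : preadditive.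
Implicit Types A B Z S T : C.

Lemma comp0m A B T (f : Hom A B) : (0 : Hom B T) ∘ f = 0.
Proof. by apply: (@addrI _ (0 ∘ f)); rewrite -compDl !addr0. Qed.

Lemma compm0 A B T (g : Hom B T) : g ∘ (0 : Hom A B) = 0.
Proof. by apply: (@addrI _ (g ∘ 0)); rewrite -compDr !addr0. Qed.

Lemma compNm A B T (g : Hom B T) (f : Hom A B) : (- g) ∘ f = - (g ∘ f).
Proof. by apply: (@addrI _ (g ∘ f)); rewrite -compDl !subrr comp0m. Qed.

Lemma compmN A B T (g : Hom B T) (f : Hom A B) : g ∘ (- f) = - (g ∘ f).
Proof. by apply: (@addrI _ (g ∘ f)); rewrite -compDr !subrr compm0. Qed.

Definition is_iso A B (f : Hom A B) :=
  exists g : Hom B A, g ∘ f = idm A /\ f ∘ g = idm B.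

Definition is_mono A B (f : Hom A B) :=
  forall T (g h : Hom T A), f ∘ g = f ∘ h -> g = h.

Definition is_epi A B (f : Hom A B) :=
  forall T (g h : Hom B T), g ∘ f = h ∘ f -> g = h.

(* Initial and terminal: the unique morphism is then the zero one. *)
Definition is_zero_object Z :=
  (forall T (f : Hom Z T), f = 0) /\ (forall T (f : Hom T Z), f = 0).

Record biproduct A B S := Biproduct {
  in1 : Hom A S;
  in2 : Hom B S;
  pr1 : Hom S A;
  pr2 : Hom S B;
  pr1_in1 : pr1 ∘ in1 = idm A;
  pr2_in2 : pr2 ∘ in2 = idm B;
  pr1_in2 : pr1 ∘ in2 = 0;
  pr2_in1 : pr2 ∘ in1 = 0;
  in_pr : in1 ∘ pr1 + in2 ∘ pr2 = idm S }.

Definition is_additive :=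
  (exists Z, is_zero_object Z) /\
  (forall A B, exists S, inhabited (biproduct A B S)).

(* The morphism f1 ⊕ f2 between two given direct sums. *)
Definition dsum_mor A1 A2 SA B1 B2 SB
    (bA : biproduct A1 A2 SA) (bB : biproduct B1 B2 SB)
    (f1 : Hom A1 B1) (f2 : Hom A2 B2) : Hom SA SB :=
  in1 bB ∘ f1 ∘ pr1 bA + in2 bB ∘ f2 ∘ pr2 bA.

Definition is_kernel A B (f : Hom A B) K (k : Hom K A) :=
  f ∘ k = 0 /\
  forall T (t : Hom T A), f ∘ t = 0 -> exists! u : Hom T K, k ∘ u = t.

Definition is_cokernel A B (f : Hom A B) Q (q : Hom B Q) :=
  q ∘ f = 0 /\
  forall T (t : Hom B T), t ∘ f = 0 -> exists! u : Hom Q T, u ∘ q = t.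

(* q : A -> Coim f and i : Im f -> B. *)
Definition is_coimage A B (f : Hom A B) Co (q : Hom A Co) :=
  exists K (k : Hom K A), is_kernel f k /\ is_cokernel k q.

Definition is_image A B (f : Hom A B) Im (i : Hom Im B) :=
  exists Q (c : Hom B Q), is_cokernel f c /\ is_kernel c i.

Definition is_canonical A B (f : Hom A B) Co (q : Hom A Co)
    Im (i : Hom Im B) (fhat : Hom Co Im) := i ∘ fhat ∘ q = f.

Lemma canonical_exists_unique A B (f : Hom A B) Co (q : Hom A Co)
    Im (i : Hom Im B) :
  is_coimage f q -> is_image f i ->
  exists! fhat : Hom Co Im, is_canonical f q i fhat.
Proof.
move=> [K [k [[fk0 _] [qk0 qU]]]] [Q [c [[cf0 _] [ci0 iU]]]].
have epi_q T (u v : Hom Co T) : u ∘ q = v ∘ q -> u = v.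
  move=> uv; have /qU [w [_ wU]] : (v ∘ q) ∘ k = 0 by rewrite -compA qk0 compm0.
  by rewrite -(wU _ uv) (wU v).
have mono_i T (u v : Hom T Im) : i ∘ u = i ∘ v -> u = v.
  move=> uv; have /iU [w [_ wU]] : c ∘ (i ∘ v) = 0 by rewrite compA ci0 comp0m.
  by rewrite -(wU _ uv) (wU v).
have [g [gq _]] := qU _ _ fk0.
have /iU [h [ih _]] : c ∘ g = 0.
  by apply: epi_q; rewrite -compA gq cf0 comp0m.
exists h; split; first by rewrite /is_canonical ih.
move=> h' h'P; apply: mono_i; apply: epi_q.
by rewrite ih gq h'P.
Qed.

Definition is_semi_abelian :=
  [/\ is_additive,
      forall A B (f : Hom A B), exists K (k : Hom K A), is_kernel f k,
      forall A B (f : Hom A B), exists Q (q : Hom B Q), is_cokernel f q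
    & forall A B (f : Hom A B) Co (q : Hom A Co) Im (i : Hom Im B),
        is_coimage f q -> is_image f i ->
        exists fhat : Hom Co Im,
          [/\ is_canonical f q i fhat, is_epi fhat & is_mono fhat]].

End Preadditive.

(* E : C^op x C -> Ab; [Emap c a] is E(c, a). *)
Record additive_bifunctor (C : preadditive) := AdditiveBifunctor {
  Ext :> C -> C -> zmodType;
  Emap : forall C1 C2 A1 A2 : C,
    Hom C2 C1 -> Hom A1 A2 -> Ext C1 A1 -> Ext C2 A2;
  EmapD : forall C1 C2 A1 A2 (c : Hom C2 C1) (a : Hom A1 A2),
    {morph Emap c a : d d' / d + d'};
  Emap1 : forall C0 A (d : Ext C0 A), Emap (idm C0) (idm A) d = d;
  Emap_comp : forall C1 C2 C3 A1 A2 A3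
      (c : Hom C2 C1) (c' : Hom C3 C2) (a : Hom A1 A2) (a' : Hom A2 A3)
      (d : Ext C1 A1),
    Emap (c ∘ c') (a' ∘ a) d = Emap c' a' (Emap c a d);
  Emap_Dl : forall C1 C2 A1 A2 (c c' : Hom C2 C1) (a : Hom A1 A2)
      (d : Ext C1 A1),
    Emap (c + c') a d = Emap c a d + Emap c' a d;
  Emap_Dr : forall C1 C2 A1 A2 (c : Hom C2 C1) (a a' : Hom A1 A2)
      (d : Ext C1 A1),
    Emap c (a + a') d = Emap c a d + Emap c a' d }.

Section Realizations.
Variables (C : preadditive) (E : additive_bifunctor C).

Definition push (D A A' : C) (a : Hom A A') (d : E D A) : E D A' :=
  Emap (idm D) a d.

Definition pull (D D' A : C) (c : Hom D' D) (d : E D A) : E D' A :=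
  Emap c (idm A) d.

Definition ext_morphism (A A' D D' : C) (d : E D A) (d' : E D' A')
    (a : Hom A A') (c : Hom D D') := push a d = pull c d'.

(* d ⊕ d': the element of E(D ⊕ D', A ⊕ A') with components (d, 0, 0, d') in
   E(D, A), E(D, A'), E(D', A), E(D', A'). *)
Definition dsum_ext (A A' SA D D' SD : C)
    (bA : biproduct A A' SA) (bD : biproduct D D' SD)
    (d : E D A) (d' : E D' A') : E SD SA :=
  Emap (pr1 bD) (in1 bA) d + Emap (pr2 bD) (in2 bA) d'.

Record sequence (A D : C) := Sequence {
  mid : C;
  seq_in : Hom A mid;
  seq_out : Hom mid D }.

Definition seq_equiv (A D : C) (s t : sequence A D) :=
  exists b : Hom (mid s) (mid t),
    [/\ is_iso b, b ∘ seq_in s = seq_in t & seq_out t ∘ b = seq_out s].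

(* [s d t] means that the sequence t belongs to the class s(d). *)
Variable s : forall A D : C, E D A -> sequence A D -> Prop.

Definition realizes (A B D : C) (x : Hom A B) (y : Hom B D) (d : E D A) :=
  s d (Sequence x y).

Definition is_realization :=
  (forall (A D : C) (d : E D A),
     exists t0, forall t, s d t <-> seq_equiv t0 t) /\
  (forall (A B D A' B' D' : C) (d : E D A) (d' : E D' A')
      (x : Hom A B) (y : Hom B D) (x' : Hom A' B') (y' : Hom B' D')
      (a : Hom A A') (c : Hom D D'),
     ext_morphism d d' a c -> realizes x y d -> realizes x' y' d' ->
     exists b : Hom B B', b ∘ x = x' ∘ a /\ y' ∘ b = c ∘ y).

Definition is_additive_realization :=
  [/\ is_realization,
      forall (A D S : C) (b : biproduct A D S),
        realizes (in1 b) (pr2 b) (0 : E D A)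
    & forall (A B D A' B' D' SA SB SD : C)
        (bA : biproduct A A' SA) (bB : biproduct B B' SB)
        (bD : biproduct D D' SD)
        (d : E D A) (d' : E D' A')
        (x : Hom A B) (y : Hom B D) (x' : Hom A' B') (y' : Hom B' D'),
        realizes x y d -> realizes x' y' d' ->
        realizes (dsum_mor bA bB x x') (dsum_mor bB bD y y')
          (dsum_ext bA bD d d')].

Definition ET3 :=
  forall (A B D A' B' D' : C) (d : E D A) (d' : E D' A')
    (x : Hom A B) (y : Hom B D) (x' : Hom A' B') (y' : Hom B' D')
    (a : Hom A A') (b : Hom B B'),
  realizes x y d -> realizes x' y' d' -> b ∘ x = x' ∘ a ->
  exists c : Hom D D', c ∘ y = y' ∘ b /\ ext_morphism d d' a c.

Definition ET3op :=
  forall (A B D A' B' D' : C) (d : E D A) (d' : E D' A')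
    (x : Hom A B) (y : Hom B D) (x' : Hom A' B') (y' : Hom B' D')
    (b : Hom B B') (c : Hom D D'),
  realizes x y d -> realizes x' y' d' -> y' ∘ b = c ∘ y ->
  exists a : Hom A A', b ∘ x = x' ∘ a /\ ext_morphism d d' a c.

Definition ET4 :=
  forall (A B C0 D F : C) (d : E D A) (d' : E F B)
    (f : Hom A B) (f' : Hom B D) (g : Hom B C0) (g' : Hom C0 F),
  realizes f f' d -> realizes g g' d' ->
  exists (W : C) (h' : Hom C0 W) (u : Hom D W) (e : Hom W F) (d'' : E W A),
    realizes (g ∘ f) h' d'' /\
    [/\ h' ∘ g = u ∘ f', e ∘ h' = g', realizes u e (push f' d'),
        pull u d'' = d & push f d'' = pull e d'].

(* Word for word ET4 of the opposite category, all arrows being reversed. *)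
Definition ET4op :=
  forall (A B C0 D F : C) (d : E A D) (d' : E B F)
    (f : Hom B A) (f' : Hom D B) (g : Hom C0 B) (g' : Hom F C0),
  realizes f' f d -> realizes g' g d' ->
  exists (W : C) (h' : Hom W C0) (u : Hom W D) (e : Hom F W) (d'' : E A W),
    realizes h' (f ∘ g) d'' /\
    [/\ g ∘ h' = f' ∘ u, h' ∘ e = g', realizes e u (pull f' d'),
        push u d'' = d & pull f d'' = push e d'].

End Realizations.

Record extriangulated := Extriangulated {
  carrier :> preadditive;
  carrier_additive : is_additive carrier;
  extension : additive_bifunctor carrier;
  realization : forall A D : carrier,
    extension D A -> sequence A D -> Prop;
  realization_additive : is_additive_realization realization;
  extri_ET3 : ET3 realization;
  extri_ET3op : ET3op realization;
  extri_ET4 : ET4 realization;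
  extri_ET4op : ET4op realization }.

Definition is_triangle (C : extriangulated) (A B D : C)
    (x : Hom A B) (y : Hom B D) (d : extension C D A) :=
  realizes (@realization C) x y d.

(* A full subcategory is given by its objects. Closure under finite direct
   sums only asks for some zero object and some direct sum of A and B to lie in
   it, so it need not be closed under isomorphism. *)
Record subcategory (C : preadditive) := Subcategory {
  objects :> C -> Prop;
  objects_zero : exists Z, is_zero_object Z /\ objects Z;
  objects_dsum : forall A B, objects A -> objects B ->
    exists S, inhabited (biproduct A B S) /\ objects S }.

Section Approximations.
Variables (C : preadditive) (X : subcategory C).

Definition left_approximation (A B : C) (f : Hom A B) :=
  X B /\ forall M, X M -> forall g : Hom A M, exists h : Hom B M, h ∘ f = g.

Definition right_approximation (A B : C) (f : Hom A B) :=
  X A /\ forall M, X M -> forall g : Hom M B, exists h : Hom M A, f ∘ h = g.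

End Approximations.

Definition pseudo_cluster_tilting (C : extriangulated) (X : subcategory C) :=
  (forall C0 : C,
     exists (X1 X2 : C) (a : Hom C0 X1) (b : Hom X1 X2) (d : extension C X2 C0),
       [/\ is_triangle a b d, X X1, X X2 & left_approximation X a]) /\
  (forall C0 : C,
     exists (X3 X4 : C) (c : Hom X3 X4) (e : Hom X4 C0) (d : extension C C0 X3),
       [/\ is_triangle c e d, X X3, X X4 & right_approximation X e]).

Section QuotientCategory.
Variables (C : preadditive) (X : subcategory C).

Definition factors_through (A B : C) (f : Hom A B) :=
  exists (M : C) (g : Hom M B) (h : Hom A M), X M /\ f = g ∘ h.

(* The subgroup X(A, B) of Hom A B. *)
Definition ideal (A B : C) : {pred Hom A B} := fun f => `[< factors_through f >].

Arguments ideal A B : clear implicits.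

Lemma idealP (A B : C) (f : Hom A B) :
  reflect (factors_through f) (f \in ideal A B).
Proof. exact: asboolP. Qed.

Fact ideal_zmod_closed (A B : C) : zmod_closed (ideal A B).
Proof.
split.
  have [Z [_ XZ]] := objects_zero X.
  by apply/idealP; exists Z, 0, 0; split=> //; rewrite compm0.
move=> _ _ /idealP[M [g [h [XM ->]]]] /idealP[N [g' [h' [XN ->]]]].
have [S [[b] XS]] := objects_dsum XM XN.
apply/idealP; exists S, (g ∘ pr1 b - g' ∘ pr2 b), (in1 b ∘ h + in2 b ∘ h').
split=> //; rewrite compDr !compDl !compNm !compA.
rewrite -(compA g) -(compA g') -(compA g (pr1 b)) -(compA g' (pr2 b) (in2 b)).
by rewrite pr1_in1 pr2_in1 pr1_in2 pr2_in2 !compm1 !compm0 !comp0m subr0 add0r.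
Qed.

HB.instance Definition _ (A B : C) :=
  GRing.isZmodClosed.Build (Hom A B) (ideal A B) (ideal_zmod_closed A B).

Definition qHom (A B : C) : zmodType := Quotient.quot (ideal A B).

Definition qproj (A B : C) (f : Hom A B) : qHom A B :=
  \pi_(Quotient.quot (ideal A B)) f.

Definition qcomp (A B D : C) (g : qHom B D) (f : qHom A B) : qHom A D :=
  qproj (repr (g : Quotient.quot (ideal B D)) ∘ repr (f : Quotient.quot (ideal A B))).

Lemma qproj_eq (A B : C) (f f' : Hom A B) :
  qproj f = qproj f' <-> factors_through (f - f').
Proof.
rewrite /qproj; split=> [/eqP|ff'].
  by rewrite -Quotient.idealrBE => /idealP.
by apply/eqP; rewrite -Quotient.idealrBE; apply/idealP.
Qed.

Lemma qproj_surj (A B : C) (f : qHom A B) : exists f0, f = qproj f0.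
Proof. by exists (repr (f : Quotient.quot (ideal A B))); rewrite /qproj reprK. Qed.

Lemma qprojD (A B : C) (f f' : Hom A B) :
  qproj (f + f') = qproj f + qproj f'.
Proof. exact: raddfD. Qed.

Lemma qprojM (A B D : C) (g : Hom B D) (f : Hom A B) :
  qproj (g ∘ f) = qcomp (qproj g) (qproj f).
Proof.
rewrite /qcomp; set g' := repr _; set f' := repr _.
have /qproj_eq [M [g1 [g2 [XM gE]]]] : qproj g = qproj g'.
  by rewrite /qproj /g' reprK.
have /qproj_eq [N [f1 [f2 [XN fE]]]] : qproj f = qproj f'.
  by rewrite /qproj /f' reprK.
transitivity (qproj (g' ∘ f)); apply/qproj_eq.
  exists M, g1, (g2 ∘ f); split=> //.
  by rewrite -compNm -compDl gE -compA.
exists N, (g' ∘ f1), f2; split=> //.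
by rewrite -compmN -compDr fE compA.
Qed.

Fact qcompA (A B D F : C) (h : qHom D F) (g : qHom B D) (f : qHom A B) :
  qcomp h (qcomp g f) = qcomp (qcomp h g) f.
Proof.
have [[h0 ->] [g0 ->] [f0 ->]] :=
  And3 (qproj_surj h) (qproj_surj g) (qproj_surj f).
by rewrite -!qprojM compA.
Qed.

Fact qcomp1m (A B : C) (f : qHom A B) : qcomp (qproj (idm B)) f = f.
Proof. by have [f0 ->] := qproj_surj f; rewrite -qprojM comp1m. Qed.

Fact qcompm1 (A B : C) (f : qHom A B) : qcomp f (qproj (idm A)) = f.
Proof. by have [f0 ->] := qproj_surj f; rewrite -qprojM compm1. Qed.

Fact qcompDl (A B D : C) (g g' : qHom B D) (f : qHom A B) :
  qcomp (g + g') f = qcomp g f + qcomp g' f.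
Proof.
have [[g0 ->] [g1 ->] [f0 ->]] :=
  And3 (qproj_surj g) (qproj_surj g') (qproj_surj f).
by rewrite -qprojD -!qprojM compDl qprojD.
Qed.

Fact qcompDr (A B D : C) (g : qHom B D) (f f' : qHom A B) :
  qcomp g (f + f') = qcomp g f + qcomp g f'.
Proof.
have [[g0 ->] [f0 ->] [f1 ->]] :=
  And3 (qproj_surj g) (qproj_surj f) (qproj_surj f').
by rewrite -qprojD -!qprojM compDr qprojD.
Qed.

Definition quotient_category : preadditive :=
  @Preadditive C qHom (fun A => qproj (idm A)) qcomp
    qcompA qcomp1m qcompm1 qcompDl qcompDr.

End QuotientCategory.

(* Main.v *)
From mathcomp Require Import all_boot all_algebra.
Require Import Defs.

(** Let [X1], [X2] be the objects of an E-triangle [A -> X1 -> X2] starting with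
    a left X-approximation [a : A -> X1]. For any [f : A -> B] the homotopy
    pushout of [f] along [a] produces two E-triangles,
      [A -> B ⊕ X1 -> M]  and  [B -> M -> X2],
    in which the second [c : B -> M] is the component on [B] of the first
    [B ⊕ X1 -> M] ([homotopy_pushout], an application of ET4). Modulo X the
    morphism [c] is a cokernel of [f]: if [t ∘ f] factors through X, then
    [t ∘ f = v ∘ a] for some [v] because [a] is an approximation, so the
    morphism [(t, -v)] on [B ⊕ X1] vanishes on [A] and descends to [M]; and [c]
    is epi modulo X because its cone [X2] lies in X
    ([homotopy_pushout_cokernel]). Kernels are dual.

    For semi-abelianness it is enough to write every [f] as [m ∘ q] with [q] a
    cokernel of a kernel of [f] and [m] mono, and dually: then [q] is the
    coimage of [f], so the canonical morphism followed by the image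
    inclusion is [m] up to an isomorphism ([canonical_mono]). To obtain [m]
    ([mono_factorization]), compare the E-triangle [K -> A ⊕ X4 -> B] that
    defines the kernel of [f] with the E-triangle [K -> A ⊕ X1 -> Q] that
    defines the cokernel of [K -> A]. By ET3 they are related by a morphism of
    E-triangles that is the identity on [K], hence the extension of the second
    is the pullback along [m : Q -> B] of the extension of the first. If [m ∘ t]
    factors through X, then it lifts along [A ⊕ X4 -> B], so it kills the
    extension of [B]; therefore [t] kills the extension of [Q] and lifts to
    [A ⊕ X1]. Modulo X this lift is a morphism to [A] that is killed by [f], so
    it factors through [K], and [t] vanishes.

    The hypotheses are self-dual, so each dual statement is obtained by passing
    to the opposite extriangulated category. Since the quotient of the opposite
    and the opposite of the quotient are built on different types of morphisms,
    the statements about kernels and cokernels are first proved in the category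
    itself, modulo the ideal of morphisms that factor through X, and dualized
    there; only then are they carried to the quotient. *)

Set Implicit Arguments.
Unset Strict Implicit.
Unset Printing Implicit Defensive.

Import GRing.Theory.
Local Open Scope ring_scope.
Local Open Scope cat_scope.

(** * The opposite of an extriangulated category *)

Definition op (C : preadditive) : preadditive :=
  @Preadditive C (fun A B => Hom B A) (fun A => idm A)
    (fun A B D g f => f ∘ g)
    (fun A B D F h g f => esym (compA f g h))
    (fun A B f => compm1 f) (fun A B f => comp1m f)
    (fun A B D g g' f => compDr f g g') (fun A B D g f f' => compDl f f' g).

Definition op_biproduct (C : preadditive) (A B S : C)
    (b : biproduct A B S) : @biproduct (op C) A B S :=
  @Biproduct (op C) A B S (pr1 b) (pr2 b) (in1 b) (in2 b)
    (pr1_in1 b) (pr2_in2 b) (pr2_in1 b) (pr1_in2 b) (in_pr b).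

Definition unop_biproduct (C : preadditive) (A B S : C)
    (b : @biproduct (op C) A B S) : biproduct A B S :=
  @Biproduct C A B S (pr1 b) (pr2 b) (in1 b) (in2 b)
    (pr1_in1 b) (pr2_in2 b) (pr2_in1 b) (pr1_in2 b) (in_pr b).

Definition swap_biproduct (C : preadditive) (A B S : C)
    (b : biproduct A B S) : biproduct B A S :=
  Biproduct (pr2_in2 b) (pr1_in1 b) (pr2_in1 b) (pr1_in2 b)
    (etrans (addrC _ _) (in_pr b)).

Lemma is_additive_op (C : preadditive) : is_additive C -> is_additive (op C).
Proof.
move=> [[Z [Z1 Z2]] dsum]; split; first by exists Z.
by move=> A B; have [S [b]] := dsum A B; exists S; split; exact: op_biproduct.
Qed.

Definition op_bifunctor (C : preadditive) (E : additive_bifunctor C) :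
    additive_bifunctor (op C) :=
  @AdditiveBifunctor (op C) (fun D A => E A D)
    (fun D1 D2 A1 A2 c a => @Emap C E A1 A2 D1 D2 a c)
    (fun D1 D2 A1 A2 c a => @EmapD C E A1 A2 D1 D2 a c)
    (fun D A d => @Emap1 C E A D d)
    (fun D1 D2 D3 A1 A2 A3 c c' a a' d =>
       @Emap_comp C E A1 A2 A3 D1 D2 D3 a a' c c' d)
    (fun D1 D2 A1 A2 c c' a d => @Emap_Dr C E A1 A2 D1 D2 a c c' d)
    (fun D1 D2 A1 A2 c a a' d => @Emap_Dl C E A1 A2 D1 D2 a a' c d).

Definition op_sequence (C : preadditive) (A D : C)
    (t : @sequence (op C) A D) : sequence D A :=
  @Sequence C D A (mid t) (seq_out t) (seq_in t).

Section OppositeRealization.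
Variables (C : preadditive) (E : additive_bifunctor C).
Variable s : forall A D : C, E D A -> sequence A D -> Prop.

Definition op_realization (A D : op C) (d : op_bifunctor E D A)
  (t : sequence A D) : Prop := s d (op_sequence t).

Lemma op_seq_equiv (A D : C) (t0 : sequence D A) (t : @sequence (op C) A D) :
  seq_equiv t0 (op_sequence t) <->
  @seq_equiv (op C) A D (@Sequence (op C) A D _ (seq_out t0) (seq_in t0)) t.
Proof.
split=> [[b [[b' [b'b bb']] /= bin bout]]|[b [[b' [b'b bb']] /= bin bout]]].
  exists b'; split; first by exists b.
    by change (seq_out t0 ∘ b' = seq_in t); rewrite -bout -compA bb' compm1.
  by change (b' ∘ seq_out t = seq_in t0); rewrite -bin compA b'b comp1m.
exists b'; split; first by exists b.
  change (@comp C _ _ _ b' (seq_in t0) = seq_out t).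
  have e : @comp C _ _ _ b' b = idm _ := bb'.
  have e' : @comp C _ _ _ b (seq_out t) = seq_in t0 := bout.
  by rewrite -e' compA e comp1m.
change (@comp C _ _ _ (seq_in t) b' = seq_out t0).
have e : @comp C _ _ _ b b' = idm _ := b'b.
have e' : @comp C _ _ _ (seq_out t0) b = seq_in t := bin.
by rewrite -e' -compA e compm1.
Qed.

(** The split sequence of [A ⊕ D] read backwards starts at [D], hence the two
    summands have to be exchanged; the direct sum of two triangles, on the
    contrary, keeps the order of its summands. *)
Lemma is_additive_realization_op :
  is_additive_realization s -> is_additive_realization op_realization.
Proof.
move=> [[cls lift] split0 sumr]; split; first split.
- move=> A D d; have [t0 t0P] := cls _ _ d.
  exists (@Sequence (op C) A D _ (seq_out t0) (seq_in t0)) => t.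
  by rewrite -op_seq_equiv; exact: t0P.
- move=> A B D A' B' D' d d' x y x' y' a c dd' rd rd'.
  have [b [b1 b2]] := lift _ _ _ _ _ _ _ _ _ _ _ _ c a (esym dd') rd' rd.
  by exists b.
- by move=> A D S b; exact: (split0 _ _ _ (swap_biproduct (unop_biproduct b))).
- move=> A B D A' B' D' SA SB SD bA bB bD d d' x y x' y' rd rd'.
  have := sumr _ _ _ _ _ _ _ _ _ (unop_biproduct bD) (unop_biproduct bB)
    (unop_biproduct bA) _ _ _ _ _ _ rd rd'.
  by rewrite /realizes /op_realization /op_sequence /dsum_mor /= !compA.
Qed.

Lemma ET3_op : ET3op s -> ET3 op_realization.
Proof.
move=> et A B D A' B' D' d d' x y x' y' a b rd rd' bx.
have [c [c1 c2]] := et _ _ _ _ _ _ _ _ _ _ _ _ b a rd' rd bx.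
by exists c.
Qed.

Lemma ET3op_op : ET3 s -> ET3op op_realization.
Proof.
move=> et A B D A' B' D' d d' x y x' y' b c rd rd' bx.
have [a [a1 a2]] := et _ _ _ _ _ _ _ _ _ _ _ _ c b rd' rd bx.
by exists a.
Qed.

End OppositeRealization.

Definition op_extriangulated (C : extriangulated) : extriangulated :=
  @Extriangulated (op C) (is_additive_op (carrier_additive C))
    (op_bifunctor (extension C)) (op_realization (@realization C))
    (is_additive_realization_op (realization_additive C))
    (ET3_op (@extri_ET3op C)) (ET3op_op (@extri_ET3 C))
    (@extri_ET4op C) (@extri_ET4 C).

Lemma op_objects_zero (C : preadditive) (X : subcategory C) :
  exists Z : op C, is_zero_object Z /\ X Z.
Proof. by have [Z [[Z1 Z2] XZ]] := objects_zero X; exists Z. Qed.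

Lemma op_objects_dsum (C : preadditive) (X : subcategory C) (A B : op C) :
  X A -> X B -> exists S : op C, inhabited (biproduct A B S) /\ X S.
Proof.
move=> XA XB; have [S [[b] XS]] := objects_dsum XA XB.
by exists S; split=> //; split; exact: op_biproduct.
Qed.

Definition op_subcategory (C : preadditive) (X : subcategory C) :
    subcategory (op C) :=
  @Subcategory (op C) X (op_objects_zero X) (@op_objects_dsum C X).

Lemma pseudo_cluster_tilting_op (C : extriangulated) (X : subcategory C) :
  pseudo_cluster_tilting X ->
  @pseudo_cluster_tilting (op_extriangulated C) (op_subcategory X).
Proof.
move=> [p2 p3]; split=> C0.
  have [X3 [X4 [c [d [e [tri X3P X4P ap]]]]]] := p3 C0.
  by exists X4, X3, d, c, e.
have [X1 [X2 [c [d [e [tri X3P X4P ap]]]]]] := p2 C0.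
by exists X2, X1, d, c, e.
Qed.

(** * Exactness properties of E-triangles *)

Section Triangles.
Variable C : extriangulated.
Implicit Types A B D T : C.

Lemma biproduct0 A D S (b : biproduct A D S) :
  is_triangle (in1 b) (pr2 b) (0 : extension C D A).
Proof. by have [_ split0 _] := realization_additive C; exact: split0. Qed.

Definition zero_biproduct_r A Z (Z0 : is_zero_object Z) : biproduct A Z A.
Proof.
exists (idm A) 0 (idm A) 0; rewrite ?comp1m ?compm0 ?comp0m //.
  by rewrite (Z0.1 _ (idm Z)).
by rewrite addr0.
Defined.

Definition zero_biproduct_l D Z (Z0 : is_zero_object Z) : biproduct Z D D.
Proof.
exists 0 (idm D) 0 (idm D); rewrite ?comp1m ?compm0 ?comp0m //.
  by rewrite (Z0.1 _ (idm Z)).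
by rewrite add0r.
Defined.

Section Exactness.
Variables (A B D : C) (x : Hom A B) (y : Hom B D) (d : extension C D A).
Hypothesis tri : is_triangle x y d.

(** The four lemmas below compare the triangle with the split triangles
    [A = A -> 0], [0 -> T = T] and [A -> A ⊕ T -> T], which realize the zero
    extension. *)
Lemma triangle_comp0 : y ∘ x = 0.
Proof.
have [[Z Z0] _] := carrier_additive C.
have [|c [cy _]] := extri_ET3 (biproduct0 (zero_biproduct_r A Z0)) tri
  (a := idm A) (b := x).
  by [].
by rewrite -cy /= compm0.
Qed.

Lemma factor_through_deflation T (t : Hom B T) :
  t ∘ x = 0 -> exists u : Hom D T, u ∘ y = t.
Proof.
move=> tx; have [[Z Z0] _] := carrier_additive C.
have [|c [cy _]] := extri_ET3 tri (biproduct0 (zero_biproduct_l T Z0))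
  (a := 0) (b := t).
  by rewrite tx compm0.
by exists c; rewrite cy /= comp1m.
Qed.

Lemma pull_deflation0 : pull y d = 0.
Proof.
have [[Z Z0] _] := carrier_additive C.
have [|a [_ <-]] := extri_ET3op (biproduct0 (zero_biproduct_l B Z0)) tri
  (b := idm B) (c := y).
  by [].
by apply: (@addrI _ (push a 0)); rewrite /push -EmapD !addr0.
Qed.

Lemma lift_through_deflation T (t : Hom T D) :
  pull t d = 0 -> exists u : Hom T B, y ∘ u = t.
Proof.
move=> td; have [_ /(_ A T) [S [b]]] := carrier_additive C.
have [[_ lift] _ _] := realization_additive C.
have [|u [_ yu]] := lift _ _ _ _ _ _ _ _ _ _ _ _ (idm A) t _ (biproduct0 b) tri.
  by rewrite /ext_morphism td /push Emap1.
by exists (u ∘ in2 b); rewrite compA yu -compA pr2_in2 compm1.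
Qed.

End Exactness.

(** ET4 is applied to the inclusion of [A] into [B ⊕ A] as the graph of [f],
    whose triangle [A -> B ⊕ A -> B] splits, followed by the inflation
    [id ⊕ a : B ⊕ A -> B ⊕ X1]. The composite is the inflation with components
    [f] and [a]; the triangle that ET4 puts on the cones is [B -> M -> X2]. *)
Lemma homotopy_pushout A B X1 X2 (a : Hom A X1) (b : Hom X1 X2) d
    (f : Hom A B) :
  is_triangle a b d ->
  exists (S : C) (s : biproduct B X1 S) (M : C) (p : Hom S M) d1
      (e : Hom M X2) d2,
    is_triangle (in1 s ∘ f + in2 s ∘ a) p d1 /\
    is_triangle (p ∘ in1 s) e d2.
Proof.
move=> tri; have [[Z Z0] dsum] := carrier_additive C.
have [S [s]] := dsum B X1; have [S0 [s0]] := dsum B A.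
(* The graph of [f] is a direct summand of [B ⊕ A] with complement [B]. *)
have inj1 : (pr1 s0 - f ∘ pr2 s0) ∘ in1 s0 = idm B.
  by rewrite compDl compNm -compA pr1_in1 pr2_in1 compm0 subr0.
have inj2 : (pr1 s0 - f ∘ pr2 s0) ∘ (in1 s0 ∘ f + in2 s0) = 0.
  rewrite compDr compA inj1 comp1m compDl compNm pr1_in2 -compA pr2_in2.
  by rewrite compm1 sub0r subrr.
have pr2i : pr2 s0 ∘ (in1 s0 ∘ f + in2 s0) = idm A.
  by rewrite compDr compA pr2_in1 comp0m add0r pr2_in2.
have sumi : (in1 s0 ∘ f + in2 s0) ∘ pr2 s0 +
    in1 s0 ∘ (pr1 s0 - f ∘ pr2 s0) = idm S0.
  rewrite compDl compDr compmN compA [LHS]addrC addrA subrK.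
  exact: in_pr.
pose graph := Biproduct pr2i inj1 (pr2_in1 s0) inj2 sumi.
have [_ _ sumr] := realization_additive C.
have tri2 := sumr _ _ _ _ _ _ _ _ _ s0 s (zero_biproduct_l X2 Z0) _ _ _ _ _ _
  (biproduct0 (zero_biproduct_r B Z0)) tri.
have [W [h' [u [e [d'' [triW [h'g _ triu _ _]]]]]]] :=
  extri_ET4 (biproduct0 graph) tri2.
(* ET4 only yields an inflation [u : B -> W]; restricting its commutative square
   to the summand [B] shows that it is the component of [h'] on [B]. *)
have uE : u = h' ∘ in1 s.
  rewrite -[u]compm1 -inj1 compA -[u ∘ _]h'g /dsum_mor /= compm1.
  by rewrite -compA compDl -!compA pr1_in1 pr2_in1 !compm0 compm1 addr0.
rewrite {}uE in triu; exists S, s, W, h', d'', e; eexists; split; last exact: triu.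
move: triW; rewrite /dsum_mor /= compm1 compDl !compDr -!compA.
rewrite !(compA (pr1 s0) (in1 s0)) !(compA (pr2 s0) (in1 s0)).
rewrite pr1_in1 pr2_in1 pr1_in2 pr2_in2 comp1m compm1 comp0m !compm0.
by rewrite addr0 add0r.
Qed.

End Triangles.

Lemma homotopy_pullback (C : extriangulated) (A B X3 X4 : C) (c : Hom X3 X4)
    (e : Hom X4 B) d (f : Hom A B) :
  is_triangle c e d ->
  exists (S : C) (s : biproduct A X4 S) (K : C) (k : Hom K S) d1
      (v : Hom X3 K) d2,
    is_triangle k (f ∘ pr1 s + e ∘ pr2 s) d1 /\
    is_triangle v (pr1 s ∘ k) d2.
Proof.
move=> tri.
have [S [s [K [k [d1 [v [d2 [tri1 tri2]]]]]]]] :=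
  @homotopy_pushout (op_extriangulated C) B A X4 X3 e c d f tri.
by exists S, (unop_biproduct s), K, k, d1, v, d2.
Qed.

(** * Kernels and cokernels modulo the ideal *)

Section FactorsThrough.
Variables (C : preadditive) (X : subcategory C).
Implicit Types A B D T : C.

Lemma factorsP A B (f : Hom A B) : factors_through X f <-> f \in @ideal C X A B.
Proof. by split=> /idealP. Qed.

Lemma factors0 A B : factors_through X (0 : Hom A B).
Proof. exact/factorsP/rpred0. Qed.

Lemma factorsB A B (f g : Hom A B) :
  factors_through X f -> factors_through X g -> factors_through X (f - g).
Proof. by rewrite !factorsP; exact: rpredB. Qed.

Lemma factorsD A B (f g : Hom A B) :
  factors_through X f -> factors_through X g -> factors_through X (f + g).
Proof. by rewrite !factorsP; exact: rpredD. Qed.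

Lemma factors_compl A B D (g : Hom B D) (f : Hom A B) :
  factors_through X f -> factors_through X (g ∘ f).
Proof.
by move=> [M [h [h' [XM ->]]]]; exists M, (g ∘ h), h'; rewrite compA.
Qed.

Lemma factors_compr A B D (g : Hom B D) (f : Hom A B) :
  factors_through X g -> factors_through X (g ∘ f).
Proof.
by move=> [M [h [h' [XM ->]]]]; exists M, h, (h' ∘ f); rewrite compA.
Qed.

Lemma factors_mid A M B (g : Hom M B) (f : Hom A M) :
  X M -> factors_through X (g ∘ f).
Proof. by move=> XM; exists M, g, f. Qed.

Lemma factors_congr A B (f g : Hom A B) :
  factors_through X (f - g) -> factors_through X g -> factors_through X f.
Proof. by move=> fg g0; rewrite -(subrK g f); exact: factorsD. Qed.

Lemma factors_sub_sym A B (f g : Hom A B) :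
  factors_through X (f - g) -> factors_through X (g - f).
Proof. by move=> fg; rewrite -opprB -sub0r; exact: factorsB (factors0 _ _) _. Qed.

Definition mono_mod A B (m : Hom A B) :=
  forall T (t : Hom T A), factors_through X (m ∘ t) -> factors_through X t.

Definition epi_mod A B (e : Hom A B) :=
  forall T (t : Hom B T), factors_through X (t ∘ e) -> factors_through X t.

(** Kernels and cokernels of the quotient category, expressed on representatives
    so that [op] exchanges them. *)
Definition kernel_mod A B (f : Hom A B) K (k : Hom K A) :=
  [/\ factors_through X (f ∘ k),
      forall T (t : Hom T A), factors_through X (f ∘ t) ->
        exists u : Hom T K, factors_through X (k ∘ u - t)
    & mono_mod k].

Definition cokernel_mod A B (f : Hom A B) Q (q : Hom B Q) :=
  [/\ factors_through X (q ∘ f),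
      forall T (t : Hom B T), factors_through X (t ∘ f) ->
        exists u : Hom Q T, factors_through X (u ∘ q - t)
    & epi_mod q].

End FactorsThrough.

Lemma factors_through_op (C : preadditive) (X : subcategory C) (A B : C)
    (f : Hom A B) :
  @factors_through (op C) (op_subcategory X) B A f <-> factors_through X f.
Proof. by split=> -[M [g [h [XM fE]]]]; exists M, h, g. Qed.

Lemma mono_mod_op (C : preadditive) (X : subcategory C) (A B : C)
    (f : Hom A B) :
  @mono_mod (op C) (op_subcategory X) B A f <-> epi_mod X f.
Proof.
by split=> fm T t; have := fm T t; rewrite !factors_through_op.
Qed.

Lemma epi_mod_op (C : preadditive) (X : subcategory C) (A B : C)
    (f : Hom A B) :
  @epi_mod (op C) (op_subcategory X) B A f <-> mono_mod X f.
Proof.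
by split=> fm T t; have := fm T t; rewrite !factors_through_op.
Qed.

Lemma kernel_mod_op (C : preadditive) (X : subcategory C) (A B Q : C)
    (f : Hom A B) (q : Hom B Q) :
  @kernel_mod (op C) (op_subcategory X) B A f Q q <-> cokernel_mod X f q.
Proof.
split=> -[q0 qU qe].
  split; [exact/factors_through_op| |exact/mono_mod_op].
  move=> T t /factors_through_op /qU [u].
  by move/factors_through_op; exists u.
split; [exact/factors_through_op| |exact/mono_mod_op].
move=> T t /factors_through_op /qU [u uP].
by exists u; apply/factors_through_op.
Qed.

Lemma cokernel_mod_op (C : preadditive) (X : subcategory C) (A B K : C)
    (f : Hom A B) (k : Hom K A) :
  @cokernel_mod (op C) (op_subcategory X) B A f K k <-> kernel_mod X f k.
Proof.
split=> -[q0 qU qe].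
  split; [exact/factors_through_op| |exact/epi_mod_op].
  move=> T t /factors_through_op /qU [u].
  by move/factors_through_op; exists u.
split; [exact/factors_through_op| |exact/epi_mod_op].
move=> T t /factors_through_op /qU [u uP].
by exists u; apply/factors_through_op.
Qed.

(** Let [c] be [p ∘ in1 s]. Any [h : B -> N] with [N] in X extends along [c],
    since [h ∘ f] extends along the approximation [a]. So, if [u ∘ c = g ∘ h]
    and [w] extends [h], then [u - g ∘ w] kills [c] and factors through its cone
    [X2]: this is why [c] is epi modulo X. *)
Lemma homotopy_pushout_cokernel (C : extriangulated) (X : subcategory C)
    (A B X1 X2 S M : C) (a : Hom A X1) (f : Hom A B) (s : biproduct B X1 S)
    (p : Hom S M) d1 (e : Hom M X2) d2 :
  left_approximation X a -> X X2 ->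
  is_triangle (in1 s ∘ f + in2 s ∘ a) p d1 ->
  is_triangle (p ∘ in1 s) e d2 ->
  cokernel_mod X f (p ∘ in1 s).
Proof.
move=> [XX1 ext] XX2 tri1 tri2.
have desc T (t : Hom B T) (v : Hom X1 T) : t ∘ f = v ∘ a ->
    exists u : Hom M T, u ∘ (p ∘ in1 s) = t.
  move=> tf; have [|u uE] :=
    factor_through_deflation tri1 (t := t ∘ pr1 s - v ∘ pr2 s).
    rewrite compDr !compDl !compNm !compA -!(compA t) -!(compA v).
    rewrite pr1_in1 pr2_in1 pr1_in2 pr2_in2 !comp1m !comp0m !compm0.
    by rewrite subr0 add0r tf subrr.
  exists u; rewrite compA uE compDl compNm -!compA pr1_in1 pr2_in1.
  by rewrite compm1 compm0 subr0.
split=> [|T t [N [g [h [XN tf]]]]|T u [N [g [h [XN uc]]]]].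
- have := triangle_comp0 tri1; rewrite compDr !compA => /eqP.
  rewrite addr_eq0 => /eqP ->; rewrite -compNm.
  exact: factors_mid.
- have [h' hE] := ext _ XN h.
  have [|u uE] := desc _ t (g ∘ h'); first by rewrite tf -hE compA.
  by exists u; rewrite uE subrr; exact: factors0.
- have [h' hE] := ext _ XN (h ∘ f).
  have [w wE] := desc _ h h' (esym hE).
  have [|v vE] := factor_through_deflation tri2 (t := u - g ∘ w).
    by rewrite compDl compNm -[X in _ - X]compA wE uc subrr.
  rewrite -(subrK (g ∘ w) u) -vE.
  by apply: factorsD; exact: factors_mid.
Qed.

Lemma homotopy_pullback_kernel (C : extriangulated) (X : subcategory C)
    (A B X3 X4 S K : C) (e : Hom X4 B)
    (f : Hom A B) (s : biproduct A X4 S) (k : Hom K S) d1 (v : Hom X3 K) d2 :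
  right_approximation X e -> X X3 ->
  is_triangle k (f ∘ pr1 s + e ∘ pr2 s) d1 ->
  is_triangle v (pr1 s ∘ k) d2 ->
  kernel_mod X f (pr1 s ∘ k).
Proof.
move=> ap XX3 tri1 tri2; apply/cokernel_mod_op.
exact: (@homotopy_pushout_cokernel (op_extriangulated C) (op_subcategory X)
  B A X4 X3 S K e f (op_biproduct s) k d1 v d2 ap XX3 tri1 tri2).
Qed.

(** * Factorizations through the coimage and the image *)

Lemma pull_comp (C : preadditive) (E : additive_bifunctor C) (A D D' T : C)
    (c : Hom D' D) (t : Hom T D') (d : E D A) :
  pull (c ∘ t) d = pull t (pull c d).
Proof. by rewrite /pull -Emap_comp comp1m. Qed.

Lemma pull0 (C : preadditive) (E : additive_bifunctor C) (A D T : C)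
    (t : Hom T D) : pull t (0 : E D A) = 0.
Proof. by apply: (@addrI _ (pull t 0)); rewrite /pull -EmapD !addr0. Qed.

(** The identity on [K] as first component of the morphism of triangles is what
    makes the extension of [Q] the pullback of that of [B] along [m]. *)
Lemma mono_factorization (C : extriangulated) (X : subcategory C) :
  pseudo_cluster_tilting X -> forall (A B : C) (f : Hom A B),
  exists (K Q : C) (k : Hom K A) (q : Hom A Q) (m : Hom Q B),
    [/\ kernel_mod X f k, cokernel_mod X k q, m ∘ q = f & mono_mod X m].
Proof.
move=> [p2 p3] A B f.
have [X3 [X4 [c [e [d [tri XX3 XX4 ap]]]]]] := p3 B.
have [S [s [K [k [dB [v [dA [triB triA]]]]]]]] := homotopy_pullback f tri.
have kerf := homotopy_pullback_kernel ap XX3 triB triA.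
have [X1 [X2 [a [b [d' [tri' XX1 XX2 ap']]]]]] := p2 K.
have [S' [s' [Q [p [dQ [o [dM [triQ trio]]]]]]]] :=
  homotopy_pushout (pr1 s ∘ k) tri'.
have cokk := homotopy_pushout_cokernel ap' XX2 triQ trio.
(* Since [K -> X1] is an approximation, the component [K -> X4] factors through
   it; this gives the middle component [g : A ⊕ X1 -> A ⊕ X4]. *)
have [j jE] := ap'.2 _ XX4 (pr2 s ∘ k).
pose g := in1 s ∘ pr1 s' + in2 s ∘ j ∘ pr2 s'.
have g1 : g ∘ in1 s' = in1 s.
  by rewrite compDl -!compA pr1_in1 pr2_in1 !compm0 compm1 addr0.
have g2 : g ∘ in2 s' = in2 s ∘ j.
  by rewrite compDl -!compA pr1_in2 pr2_in2 compm0 compm1 add0r.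
have [|m [mp]] := extri_ET3 triQ triB (a := idm K) (b := g).
  rewrite compDr !compA g1 g2 -(compA _ j) jE !compA -compDl in_pr.
  by rewrite comp1m compm1.
rewrite /ext_morphism /push Emap1 => dQE.
have mq : m ∘ (p ∘ in1 s') = f.
  rewrite compA mp -compA g1 compDl -!compA pr1_in1 pr2_in1.
  by rewrite compm0 addr0 compm1.
exists K, Q, (pr1 s ∘ k), (p ∘ in1 s'), m; split=> // T t [N [r [z [XN mt]]]].
have [r' rE] := ap.2 _ XN r.
(* As [X4 -> B] is an approximation, [m ∘ t] factors through the deflation onto
   [B], along which the extension of [B] pulls back to zero. *)
have mtE : m ∘ t = (f ∘ pr1 s + e ∘ pr2 s) ∘ (in2 s ∘ r' ∘ z).
  rewrite mt -rE compDl -!compA (compA (pr1 s)) (compA (pr2 s)).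
  by rewrite pr1_in2 pr2_in2 comp0m comp1m compm0 add0r.
have [|w wE] := lift_through_deflation triQ (t := t).
  by rewrite dQE -pull_comp mtE pull_comp (pull_deflation0 triB) pull0.
(* The second summand factors through [X1], so modulo X the morphism [t] is the
   cokernel composed with the component of [w] on [A]. *)
have tE : t = p ∘ in1 s' ∘ (pr1 s' ∘ w) + p ∘ in2 s' ∘ (pr2 s' ∘ w).
  rewrite -wE -{1}[w]comp1m -(in_pr s') compDl compDr.
  by rewrite !compA.
have ft1 : factors_through X (f ∘ (pr1 s' ∘ w)).
  have -> : f ∘ (pr1 s' ∘ w) = m ∘ t - m ∘ (p ∘ in2 s') ∘ (pr2 s' ∘ w).
    rewrite tE compDr (compA m _ (pr1 s' ∘ w)) mq (compA m _ (pr2 s' ∘ w)).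
    by rewrite addrK.
  apply: factorsB; first by exists N, r, z.
  exact: factors_mid.
have [qk _ _] := cokk; have [_ /(_ _ _ ft1) [u ku] _] := kerf.
rewrite tE; apply: factorsD; last exact: factors_mid.
apply: (factors_congr (g := p ∘ in1 s' ∘ (pr1 s ∘ k ∘ u))).
  rewrite -compmN -compDr; apply: factors_compl; exact: factors_sub_sym.
by rewrite compA; exact: factors_compr.
Qed.

Lemma epi_factorization (C : extriangulated) (X : subcategory C) :
  pseudo_cluster_tilting X -> forall (A B : C) (f : Hom A B),
  exists (Q I : C) (q : Hom B Q) (i : Hom I B) (e : Hom A I),
    [/\ cokernel_mod X f q, kernel_mod X q i, i ∘ e = f & epi_mod X e].
Proof.
move=> pct A B f.
have [Q [I [q [i [e [/kernel_mod_op qP /cokernel_mod_op iP ie em]]]]]] :=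
  @mono_factorization (op_extriangulated C) (op_subcategory X)
    (pseudo_cluster_tilting_op pct) B A f.
by exists Q, I, q, i, e; split=> //; apply/mono_mod_op.
Qed.

(** * A criterion for the canonical morphism *)

Lemma kernel_mono (P : preadditive) (A B K : P) (f : Hom A B) (k : Hom K A) :
  is_kernel f k -> is_mono k.
Proof.
move=> [fk kU] T g h gh; have [|u [_ uU]] := kU _ (k ∘ h).
  by rewrite compA fk comp0m.
by rewrite -(uU g gh) (uU h).
Qed.

Lemma cokernel_epi (P : preadditive) (A B Q : P) (f : Hom A B) (q : Hom B Q) :
  is_cokernel f q -> is_epi q.
Proof. exact: (@kernel_mono (op P) B A Q f q). Qed.

(** Both [q] and [q'] are cokernels of a kernel of [f], so they differ by an
    isomorphism [v]; cancelling [q'] in [i ∘ fhat ∘ q' = f = m ∘ v ∘ q'] gives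
    [i ∘ fhat = m ∘ v], which is mono. *)
Lemma canonical_mono (P : preadditive) (A B K Q : P) (f : Hom A B)
    (k : Hom K A) (q : Hom A Q) (m : Hom Q B) :
  is_kernel f k -> is_cokernel k q -> m ∘ q = f -> is_mono m ->
  forall (Co Im : P) (q' : Hom A Co) (i : Hom Im B) (fhat : Hom Co Im),
    is_coimage f q' -> is_canonical f q' i fhat -> is_mono fhat.
Proof.
move=> [fk kU] cokq mq mm Co Im q' i fhat [K' [k' [[fk' k'U] cokq']]] can.
have [qk qU] := cokq; have [q'k' q'U] := cokq'.
have [w [k'w _]] := k'U _ _ fk.
have [w' [kw' _]] := kU _ _ fk'.
have [|v [vq' _]] := q'U _ q; first by rewrite -kw' compA qk comp0m.
have [|v' [v'q _]] := qU _ q'; first by rewrite -k'w compA q'k' comp0m.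
have v'v : v' ∘ v = idm Co.
  by apply: (cokernel_epi cokq'); rewrite -compA vq' v'q comp1m.
have ifE : i ∘ fhat = m ∘ v.
  by apply: (cokernel_epi cokq'); rewrite can -compA vq' mq.
move=> T g h gh; rewrite -[g]comp1m -[h]comp1m -v'v -!compA; congr comp.
by apply: mm; rewrite !compA -ifE -!compA gh.
Qed.

Lemma canonical_epi (P : preadditive) (A B Q I : P) (f : Hom A B)
    (q : Hom B Q) (i : Hom I B) (e : Hom A I) :
  is_cokernel f q -> is_kernel q i -> i ∘ e = f -> is_epi e ->
  forall (Co Im : P) (q' : Hom A Co) (i' : Hom Im B) (fhat : Hom Co Im),
    is_image f i' -> is_canonical f q' i' fhat -> is_epi fhat.
Proof.
move=> qP iP ie ee Co Im q' i' fhat im can.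
apply: (@canonical_mono (op P) B A Q I f q i e qP iP ie ee Im Co i' q' fhat im).
by rewrite /is_canonical /= compA; exact: can.
Qed.

(** * Passage to the quotient category *)

Section QuotientTransfer.
Variables (C : preadditive) (X : subcategory C).
Local Notation CX := (quotient_category X).

Lemma qproj0 (A B : C) : qproj X (0 : Hom A B) = 0.
Proof. by apply: (@addrI _ (qproj X 0)); rewrite -qprojD !addr0. Qed.

Lemma qproj_eq0 (A B : C) (f : Hom A B) :
  qproj X f = 0 <-> factors_through X f.
Proof. by rewrite -qproj0 qproj_eq subr0. Qed.

Lemma quotient_additive : is_additive C -> is_additive CX.
Proof.
move=> [[Z [Z1 Z2]] dsum]; split.
  by exists Z; split=> T f; have [f0 ->] := qproj_surj f;
    rewrite ?(Z1 _ f0) ?(Z2 _ f0) qproj0.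
move=> A B; have [S [b]] := dsum A B; exists S; split.
exists (qproj X (in1 b) : @Hom CX A S) (qproj X (in2 b) : @Hom CX B S)
  (qproj X (pr1 b) : @Hom CX S A) (qproj X (pr2 b) : @Hom CX S B).
- by rewrite /= -qprojM pr1_in1.
- by rewrite /= -qprojM pr2_in2.
- by rewrite /= -qprojM pr1_in2 qproj0.
- by rewrite /= -qprojM pr2_in1 qproj0.
- by rewrite /= -!qprojM -qprojD in_pr.
Qed.

Lemma quotient_mono (A B : C) (m : Hom A B) :
  mono_mod X m -> @is_mono CX A B (qproj X m).
Proof.
move=> mm T g h; have [g0 ->] := qproj_surj g; have [h0 ->] := qproj_surj h.
rewrite /= -!qprojM !qproj_eq -compmN -compDr; exact: mm.
Qed.

Lemma quotient_epi (A B : C) (e : Hom A B) :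
  epi_mod X e -> @is_epi CX A B (qproj X e).
Proof.
move=> ee T g h; have [g0 ->] := qproj_surj g; have [h0 ->] := qproj_surj h.
rewrite /= -!qprojM !qproj_eq -compNm -compDl; exact: ee.
Qed.

Lemma quotient_kernel (A B K : C) (f : Hom A B) (k : Hom K A) :
  kernel_mod X f k -> @is_kernel CX A B (qproj X f) K (qproj X k).
Proof.
move=> [fk kU km]; split; first by rewrite /= -qprojM; apply/qproj_eq0.
move=> T t; have [t0 ->] := qproj_surj t.
rewrite /= -qprojM => /qproj_eq0 /kU [u /qproj_eq ut].
exists (qproj X u); split; first by rewrite -qprojM.
by move=> u' u't; apply: (quotient_mono km); rewrite /= u't -qprojM.
Qed.

Lemma quotient_cokernel (A B Q : C) (f : Hom A B) (q : Hom B Q) :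
  cokernel_mod X f q -> @is_cokernel CX A B (qproj X f) Q (qproj X q).
Proof.
move=> [qf qU qe]; split; first by rewrite /= -qprojM; apply/qproj_eq0.
move=> T t; have [t0 ->] := qproj_surj t.
rewrite /= -qprojM => /qproj_eq0 /qU [u /qproj_eq ut].
exists (qproj X u); split; first by rewrite -qprojM.
by move=> u' u't; apply: (quotient_epi qe); rewrite /= u't -qprojM.
Qed.

End QuotientTransfer.

Theorem theorem3p9 (C : extriangulated) (X : subcategory C) :
  pseudo_cluster_tilting X -> is_semi_abelian (quotient_category X).
Proof.
move=> pct; split.
- exact: quotient_additive (carrier_additive C).
- move=> A B f; have [f0 ->] := qproj_surj f.
  have [K [_ [k [_ [_ [kP _ _ _]]]]]] := mono_factorization pct f0.
  by exists K, (qproj X k); exact: quotient_kernel.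
- move=> A B f; have [f0 ->] := qproj_surj f.
  have [Q [_ [q [_ [_ [qP _ _ _]]]]]] := epi_factorization pct f0.
  by exists Q, (qproj X q); exact: quotient_cokernel.
move=> A B f; have [f0 ->] := qproj_surj f => Co q Im i coim im.
have [fhat [can _]] := canonical_exists_unique coim im.
have [K [Q [k [q1 [m [kP q1P mq mm]]]]]] := mono_factorization pct f0.
have [Q' [I [q2 [i2 [e [q2P i2P ie ee]]]]]] := epi_factorization pct f0.
exists fhat; split=> //.
- apply: (canonical_epi (quotient_cokernel q2P) (quotient_kernel i2P) _
    (quotient_epi ee) im can).
  by rewrite /= -qprojM ie.
- apply: (canonical_mono (quotient_kernel kP) (quotient_cokernel q1P) _
    (quotient_mono mm) coim can).
  by rewrite /= -qprojM mq.
Qed.
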